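(* Let $G = K_n$ with $n \geq 4$, let $t = \binom{n}{2}$, and let $m\in\mathbb{N}$. If $m > 2^{t+1} + t + n - 6$ and $\mathcal{H} = (L,H)$ is a full $m$-fold cover of $G$ satisfying $P_{DP}(G, \mathcal{H}) = P_{DP}^*(G,m)$, then $H$ is triangle-free. Moreover, when $m > 2^{t+1} + t + n - 6$, $$f(m) - 2^{t}m^{n-4} \leq P^*_{DP}(G,m) \leq f(m) + 2^{t}m^{n-4},$$ where $$f(m) = m^n - t m^{n-1} + \binom{t}{2} m^{n-2} - \left(\binom{t}{3} - \binom{n}{3} - 3\binom{n}{4} \right) m^{n-3}.$$
   Context: All graphs are nonempty, finite and simple; $\mathbb{N}=\{1,2,3,\ldots\}$; $K_n$ is the complete graph on $n$ vertices. For a graph $H$ and $A,B\subseteq V(H)$, $E_H(A,B)$ is the set of edges of $H$ with one endpoint in $A$ and the other in $B$. A (DP-)cover of a graph $G$ is a pair $\mathcal{H}=(L,H)$, where $H$ is a graph and $L:V(G)\to 2^{V(H)}$ is a function such that: (1) $\{L(v):v\in V(G)\}$ is a partition of $V(H)$ into $|V(G)|$ parts; (2) for every pair of adjacent vertices $u,v\in V(G)$, the edges in $E_H(L(u),L(v))$ form a (possibly empty) matching; (3) $E(H)=\bigcup_{uv\in E(G)}E_H(L(u),L(v))$. It is an $m$-fold cover if $|L(v)|=m$ for all $v\in V(G)$, and an $m$-fold cover is full if $|E_H(L(u),L(v))|=m$ for each $uv\in E(G)$. A transversal of $\mathcal{H}$ is a set $T\subseteq V(H)$ containing exactly one vertex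 of $L(v)$ for each $v\in V(G)$; it is a proper $\mathcal{H}$-coloring of $G$ if it is an independent set in $H$. $P_{DP}(G,\mathcal{H})$ denotes the number of proper $\mathcal{H}$-colorings of $G$. The dual DP color function $P^*_{DP}(G,m)$ is the maximum of $P_{DP}(G,\mathcal{H})$ over all full $m$-fold covers $\mathcal{H}$ of $G$. *)

(* Defs.v *)
From mathcomp Require Import all_boot.
From mathcomp Require Import boolp.
From mathcomp Require classical_sets.
Set Implicit Arguments.
Unset Strict Implicit.
Unset Printing Implicit Defensive.

Record sgraph := SGraph {
  vertex :> finType;
  adj : rel vertex;
  adj_sym : symmetric adj;
  adj_irr : irreflexive adj }.

Definition complete_rel n : rel 'I_n := fun i j => i != j.

Lemma complete_rel_sym n : symmetric (@complete_rel n).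
Proof. by move=> i j; rewrite /complete_rel eq_sym. Qed.

Lemma complete_rel_irr n : irreflexive (@complete_rel n).
Proof. by move=> i; rewrite /complete_rel eqxx. Qed.

Definition complete_graph n : sgraph :=
  SGraph (@complete_rel_sym n) (@complete_rel_irr n).

Section Graph.
Variable H : sgraph.
Implicit Types (A B T : {set H}) (M : {set {set H}}).

(* Edges are two-element vertex sets. *)
Definition edges_between A B : {set {set H}} :=
  [set [set x; y] | x in A, y in B & adj x y].

Definition edges : {set {set H}} := edges_between [set: H] [set: H].

Definition matching M := (M \subset edges) && trivIset M.

Definition independent T := [forall x in T, forall y in T, ~~ adj x y].

Definition triangle_free :=
  forall x y z : H, ~ [/\ adj x y, adj y z & adj x z].

End Graph.

Record dp_cover (G : sgraph) := DPCover {
  cover_graph : sgraph;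
  cover_list : G -> {set cover_graph};
  cover_partition :
    partition [set cover_list v | v : G] [set: cover_graph]
    /\ #|[set cover_list v | v : G]| = #|G|;
  cover_matching : forall u v : G, adj u v ->
    matching (edges_between (cover_list u) (cover_list v));
  cover_edges :
    edges cover_graph =
      \bigcup_(p : G * G | adj p.1 p.2)
         edges_between (cover_list p.1) (cover_list p.2) }.

Section Cover.
Variables (G : sgraph) (HH : dp_cover G).
Local Notation H := (cover_graph HH).
Local Notation L := (@cover_list G HH).

Definition m_fold m := forall v : G, #|L v| = m.

Definition full_m_fold m :=
  m_fold m /\ forall u v : G, adj u v -> #|edges_between (L u) (L v)| = m.

Definition transversal (T : {set H}) := [forall v : G, #|T :&: L v| == 1].

Definition P_DP : nat :=
  #|[set T : {set H} | transversal T && independent T]|.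

End Cover.

Definition is_dual_max (G : sgraph) (m p : nat) : Prop :=
  (exists2 HH : dp_cover G, full_m_fold HH m & P_DP HH = p) /\
  (forall HH : dp_cover G, full_m_fold HH m -> P_DP HH <= p).

(* The maximum exists and is unique whenever 0 < m (dual_P_DP_max below);
   0 is only a default value for the case where there is no full m-fold
   cover. *)
Definition dual_P_DP (G : sgraph) (m : nat) : nat :=
  classical_sets.xget 0 (is_dual_max G m).

Lemma is_dual_max_unique G m p q :
  is_dual_max G m p -> is_dual_max G m q -> p = q.
Proof.
move=> [[A fA <-] maxp] [[B fB <-] maxq].
by apply/eqP; rewrite eqn_leq maxp // maxq.
Qed.

Section IdentityCover.
Variables (G : sgraph) (m : nat).
Hypothesis m_gt0 : 0 < m.

Definition id_rel : rel (G * 'I_m)%type :=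
  fun x y => adj x.1 y.1 && (x.2 == y.2).

Lemma id_rel_sym : symmetric id_rel.
Proof. by move=> x y; rewrite /id_rel adj_sym eq_sym. Qed.

Lemma id_rel_irr : irreflexive id_rel.
Proof. by move=> x; rewrite /id_rel adj_irr. Qed.

Definition id_graph : sgraph := SGraph id_rel_sym id_rel_irr.

Definition id_list (v : G) : {set id_graph} := [set x | x.1 == v].

Lemma id_list_inj : injective id_list.
Proof.
move=> u v /setP /(_ (u, Ordinal m_gt0)).
by rewrite !inE /= eqxx => /esym/eqP.
Qed.

Lemma id_partition :
  partition [set id_list v | v : G] [set: id_graph]
  /\ #|[set id_list v | v : G]| = #|G|.
Proof.
split; last by rewrite card_imset //; exact: id_list_inj.
apply/and3P; split.
- apply/eqP/setP => x; rewrite inE; apply/bigcupP.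
  by exists (id_list x.1); [apply: imset_f | rewrite inE].
- apply/trivIsetP => _ _ /imsetP[u _ ->] /imsetP[v _ ->] neq.
  rewrite -setI_eq0; apply/eqP/setP => x; rewrite !inE.
  by apply/negP => /andP[/eqP xu /eqP xv]; rewrite -xu xv eqxx in neq.
- apply/imsetP => -[v _ /setP /(_ (v, Ordinal m_gt0))].
  by rewrite !inE /= eqxx.
Qed.

Lemma id_edges_between (u v : G) : adj u v ->
  edges_between (id_list u) (id_list v) =
  [set [set ((u, i) : id_graph); (v, i)] | i : 'I_m].
Proof.
move=> uv; apply/setP => e; apply/imset2P/imsetP.
- case=> -[a i] [b j]; rewrite !inE /= => /eqP->.
  by case/andP=> /eqP-> /andP[_ /= /eqP<-] ->; exists i.
- case=> i _ ->; exists (u, i) (v, i) => //; rewrite !inE ?eqxx //=.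
  by rewrite /id_rel /= uv eqxx.
Qed.

Lemma id_matching (u v : G) : adj u v ->
  matching (edges_between (id_list u) (id_list v)).
Proof.
move=> uv; apply/andP; split.
  apply/fintype.subsetP => e /imset2P[x y xu]; rewrite inE => /andP[_ xy] ->.
  by apply/imset2P; exists x y; rewrite ?inE.
rewrite id_edges_between //; apply/trivIsetP => _ _ /imsetP[i _ ->] /imsetP[j _ ->] neq.
rewrite -setI_eq0; apply/eqP/setP => -[w k]; rewrite !inE !xpair_eqE.
apply/negP => /andP[ki kj].
have ei : k = i by case/orP: ki => /andP[_ /eqP].
have ej : k = j by case/orP: kj => /andP[_ /eqP].
by move: neq; rewrite -ei -ej eqxx.
Qed.

Lemma id_edges :
  edges id_graph =
    \bigcup_(p : G * G | adj p.1 p.2)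
       edges_between (id_list p.1) (id_list p.2).
Proof.
apply/setP => e; apply/imset2P/bigcupP.
- case=> x y _; rewrite inE => /andP[_ xy] ->.
  case/andP: (xy) => xy1 _; exists (x.1, y.1) => //.
  by apply/imset2P; exists x y; rewrite ?inE ?eqxx.
- case=> p _ /imset2P[x y _]; rewrite inE => /andP[_ xy] ->.
  by exists x y; rewrite ?inE.
Qed.

Definition id_cover : dp_cover G :=
  DPCover id_partition id_matching id_edges.

Lemma id_cover_full : full_m_fold id_cover m.
Proof.
split=> [v|u v uv] /=.
  rewrite -[RHS]card_ord -[RHS](card_imset _ (f := fun i => (v, i))).
    apply: eq_card => -[w i]; rewrite !inE /=.
    by apply/eqP/imsetP => [->|[j _ [-> _]] //]; exists i.
  by move=> i j /= [].
rewrite id_edges_between // card_imset ?card_ord // => i j.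
move=> /setP /(_ (u, i)); rewrite !inE !xpair_eqE !eqxx /= => /esym.
by case/orP=> [/eqP //|/andP[_ /eqP]].
Qed.

End IdentityCover.

Lemma P_DP_bounded (G : sgraph) m (HH : dp_cover G) :
  full_m_fold HH m -> P_DP HH <= 2 ^ (#|G| * m).
Proof.
case=> fold _; apply: leq_trans (max_card _) _.
have [part cardL] := cover_partition HH.
rewrite -cardsT -powersetT card_powerset leq_exp2l //.
rewrite (card_partition part) -cardL -sum_nat_const; apply: leq_sum => A.
by case/imsetP=> v _ ->; rewrite fold.
Qed.

Lemma dual_P_DP_max (G : sgraph) m :
  0 < m -> is_dual_max G m (dual_P_DP G m).
Proof.
move=> m_gt0; rewrite /dual_P_DP.
pose att p := `[< exists2 HH : dp_cover G, full_m_fold HH m & P_DP HH = p >].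
have ex : exists p, att p.
  exists (P_DP (id_cover G m_gt0)); apply/asboolP.
  by exists (id_cover G m_gt0) => //; exact: id_cover_full.
have ub p : att p -> p <= 2 ^ (#|G| * m).
  by move=> /asboolP[HH full <-]; exact: P_DP_bounded.
case: (ex_maxnP ex ub) => p /asboolP attp maxp.
have : is_dual_max G m p.
  by split=> // HH full; apply: maxp; apply/asboolP; exists HH.
exact: (@classical_sets.xgetI _ 0 (is_dual_max G m) p).
Qed.

(* Main.v *)
(* Writing a full m-fold cover of K_n as a system of bijections between the
   lists, let N(S) be the number of transversals in which every edge of S is
   an edge of H. If a vertex of degree one in S is deleted, N is multiplied by
   m; hence N(S) = m^(n-|S|) for every forest S. A triangle-free graph with no
   leaf and at most four edges is a 4-cycle, so up to size four only triangles
   and 4-cycles escape this formula, and the Bonferroni inequalities of orders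
   four and five pin down the number of proper colorings up to O(m^(n-4)),
   apart from the triangle term. A single triangle of H costs at least
   m^(n-3) colorings, of which the edge sets consisting of a triangle and one
   more edge give back a fraction at most (t-3)/m.
   For the lower bound, use a derangement r of the colors, read from i to j
   for i < j. It creates no triangle, since r (r x) = r x would fix x, and if
   r is an involution outside three colors (unavoidable when m is odd), all
   but three colors close up along every 4-cycle. *)
Require Import Defs.
From mathcomp Require Import all_boot all_order all_algebra.
From mathcomp Require Import zify.
From mathcomp Require boolp.
Import Order.TTheory GRing.Theory Num.Theory.
Set Implicit Arguments.
Unset Strict Implicit.
Unset Printing Implicit Defensive.

(** * Small edge sets *)

Section EdgeSets.
Variable V : finType.
Implicit Types (a b c d u v : V) (e A : {set V}) (S : {set {set V}}).

Definition pairs : {set {set V}} := [set e : {set V} | #|e| == 2].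

Lemma card_pairs : #|pairs| = 'C(#|V|, 2).
Proof. exact: card_draws. Qed.

Lemma set2_pairs a b : ([set a; b] \in pairs) = (a != b).
Proof. by rewrite inE cards2; case: (a != b). Qed.

Lemma eq_set2 a b c d :
  ([set a; b] == [set c; d]) = (a == c) && (b == d) || (a == d) && (b == c).
Proof.
apply/eqP/orP => [E|[/andP[/eqP-> /eqP->] //|/andP[/eqP-> /eqP->]]]; last first.
  by rewrite setUC.
move/setP: E => E.
have:= E a; have:= E b; have:= E c; have:= E d; rewrite !inE !eqxx ?orbT /=.
rewrite (eq_sym d a) (eq_sym d b) (eq_sym c a) (eq_sym c b).
case: (eqVneq a c) => [->|_]; case: (eqVneq b d) => [->|_];
  case: (eqVneq a d) => [|_]; case: (eqVneq b c) => [|_] //=; by auto.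
Qed.

(** When [S] consists of pairs, the three vertices are automatically distinct, because [[set a; a]]
    is a singleton. *)
Definition has_triangle S := [exists a, exists b, exists c,
  [&& [set a; b] \in S, [set b; c] \in S & [set a; c] \in S]].

Lemma has_triangleP S :
  reflect (exists a b c,
    [/\ [set a; b] \in S, [set b; c] \in S & [set a; c] \in S])
    (has_triangle S).
Proof.
apply: (iffP existsP) => [[a /existsP[b /existsP[c /and3P[]]]]|[a [b [c []]]] *].
  by exists a, b, c.
by exists a; apply/existsP; exists b; apply/existsP; exists c; apply/and3P.
Qed.

Lemma has_triangleS S1 S2 :
  S1 \subset S2 -> has_triangle S1 -> has_triangle S2.
Proof.
move=> /fintype.subsetP sub /has_triangleP[a [b [c [h1 h2 h3]]]].
by apply/has_triangleP; exists a, b, c; split; apply: sub.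
Qed.

(** The vertex of degree one is [v]; [u] is its only neighbor. *)
Definition leaf S u v :=
  [&& u != v, [set u; v] \in S &
      [forall e in S, (v \in e) ==> (e == [set u; v])]].

Definition has_leaf S := [exists u, exists v, leaf S u v].

(** Lets a walk arriving at [b] from [a] go on without turning back: otherwise [b] would be a leaf
    attached to [a]. *)
Lemma leafless_next S a b : S \subset pairs -> ~~ has_leaf S ->
  [set a; b] \in S -> exists2 c, c != a & [set b; c] \in S.
Proof.
move=> /fintype.subsetP SP nl abS; have:= SP _ abS; rewrite set2_pairs => ab.
move: nl; rewrite negb_exists => /forallP /(_ a).
rewrite negb_exists => /forallP /(_ b); rewrite /leaf ab abS /= negb_forall.
case/existsP => e; rewrite !negb_imply => /and3P[eS be nab].
move: (SP _ eS); rewrite inE => /cards2P[x [y [xy exy]]].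
rewrite {e}exy !inE in eS be nab.
wlog bx : x y xy eS be nab / b = x.
  move=> H; case/orP: (be) => /eqP bE.
    by apply: (H x y).
  apply: (H y x) => //; [by rewrite eq_sym | by rewrite setUC |
    by rewrite orbC | by rewrite setUC].
subst x; exists y => //.
by apply: contraNneq nab => ->; rewrite setUC.
Qed.

(** * Four-cycles and their number *)

Definition biclique (e1 e2 : {set V}) : {set {set V}} :=
  [set [set x; y] | x in e1, y in e2].

Definition disjoint_pairs : {set {set V} * {set V}} :=
  [set p | [&& p.1 \in pairs, p.2 \in pairs & [disjoint p.1 & p.2]]].

(** A 4-cycle is encoded as the complete bipartite graph between its two diagonals, the pairs of
    opposite vertices. *)
Definition four_cycles : {set {set {set V}}} :=
  [set biclique p.1 p.2 | p in disjoint_pairs].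

Lemma biclique_set2 (e1 e2 : {set V}) x y :
  ([set x; y] \in biclique e1 e2)
  = (x \in e1) && (y \in e2) || (x \in e2) && (y \in e1).
Proof.
apply/imset2P/orP => [[u v u1 v2 /eqP]|[]/andP[h1 h2]].
- by rewrite eq_set2 => /orP[] /andP[/eqP-> /eqP->]; rewrite u1 v2; auto.
- by exists x y.
- by exists y x; rewrite // setUC.
Qed.

Lemma card_biclique (e1 e2 : {set V}) :
  [disjoint e1 & e2] -> #|biclique e1 e2| = #|e1| * #|e2|.
Proof.
move=> dis; rewrite /biclique curry_imset2X card_in_imset ?cardsX //.
move=> [x y] [x' y']; rewrite !inE /= => /andP[x1 y2] /andP[x1' y2'] /eqP.
rewrite eq_set2 => /orP[/andP[/eqP-> /eqP->]//|/andP[/eqP xy' _]].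
by move: (disjointFr dis x1); rewrite xy' y2'.
Qed.

Lemma biclique_pairs (e1 e2 : {set V}) :
  [disjoint e1 & e2] -> biclique e1 e2 \subset pairs.
Proof.
move=> dis; apply/fintype.subsetP => _ /imset2P[x y x1 y2 ->].
rewrite set2_pairs; apply: contraTneq y2 => <-.
by rewrite (disjointFr dis x1).
Qed.

Lemma four_cycles_pairs S : S \in four_cycles -> S \subset pairs.
Proof.
case/imsetP=> p; rewrite !inE => /and3P[_ _ dis] ->.
exact: biclique_pairs.
Qed.

Lemma four_cycles_card S : S \in four_cycles -> #|S| = 4.
Proof.
case/imsetP=> p; rewrite !inE => /and3P[/eqP h1 /eqP h2 dis] ->.
by rewrite card_biclique // h1 h2.
Qed.

Lemma four_cycles_triangle S : S \in four_cycles -> ~~ has_triangle S.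
Proof.
case/imsetP=> p; rewrite !inE => /and3P[_ _ dis] ->.
apply/has_triangleP => -[a [b [c []]]]; rewrite !biclique_set2.
have D x : ~~ ((x \in p.1) && (x \in p.2)).
  by apply/negP => /andP[x1]; rewrite (disjointFr dis x1).
move: (D a) (D b) (D c).
by case: (a \in p.1); case: (b \in p.1); case: (c \in p.1);
  case: (a \in p.2); case: (b \in p.2); case: (c \in p.2).
Qed.

Lemma biclique_nbr (e1 e2 : {set V}) x : [disjoint e1 & e2] ->
  [set y | [set x; y] \in biclique e1 e2]
  = if x \in e1 then e2 else if x \in e2 then e1 else set0.
Proof.
move=> dis; apply/setP=> y; rewrite inE biclique_set2.
case: ifP => [x1|_]; first by rewrite (disjointFr dis x1) orbF.
by case: ifP => [x2|_]; rewrite ?inE.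
Qed.

(** The neighborhood of a vertex of one side is the other side, so the neighborhoods of one vertex
    from each side recover the sides up to order. *)
Lemma biclique_inj (p q : {set V} * {set V}) :
  p \in disjoint_pairs -> q \in disjoint_pairs ->
  biclique p.1 p.2 = biclique q.1 q.2 -> q = p \/ q = (p.2, p.1).
Proof.
case: p q => [p1 p2] [q1 q2]; rewrite !inE /=.
case/and3P=> p1P p2P dp /and3P[q1P q2P dq] E.
have N x := biclique_nbr x dp; rewrite E in N.
have [a aP] : exists a, a \in p1.
  by apply/set0Pn; rewrite -card_gt0 (eqP p1P).
have [b bP] : exists b, b \in p2.
  by apply/set0Pn; rewrite -card_gt0 (eqP p2P).
have ab : (b \in p1) = false by exact: disjointFl dp bP.
have ba : (a \in p2) = false by exact: disjointFr dp aP.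
have := N a; have := N b; rewrite !biclique_nbr // aP bP ab.
case: ifP => b1; last case: ifP => b2; case: ifP => a1; try case: ifP => a2.
all: move=> E1 E2; try by [left; rewrite E1 E2 | right; rewrite E1 E2].
all: by move: aP bP ab ba; rewrite -?E1 -?E2 ?inE // => -> .
Qed.

Lemma card_disjoint_pairs : #|disjoint_pairs| = 'C(#|V|, 2) * 'C(#|V| - 2, 2).
Proof.
rewrite -sum1_card (eq_bigl (fun p : {set V} * {set V} =>
  (p.1 \in pairs) && ((p.2 \subset ~: p.1) && (#|p.2| == 2)))); last first.
  by move=> p; rewrite !inE disjoint_sym -setCS setCK -disjoints_subset
    disjoint_sym andbC; case: (#|p.2| == 2); rewrite ?andbT ?andbF // andbC.
rewrite -(pair_big_dep (fun e => e \in pairs)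
  (fun e1 e2 => (e2 \subset ~: e1) && (#|e2| == 2)) (fun _ _ => 1)) /=.
rewrite (eq_bigr (fun=> 'C(#|V| - 2, 2))) => [|e]; last first.
  rewrite inE => /eqP e2; rewrite sum1dep_card cards_draws.
  by rewrite cardsCs setCK e2.
by rewrite sum_nat_const card_pairs.
Qed.

(** Each 4-cycle comes from exactly two ordered pairs of diagonals, and for [n] vertices
    ['C(n, 2) * 'C(n - 2, 2)] is six times ['C(n, 4)]. *)
Lemma card_four_cycles : #|four_cycles| = 3 * 'C(#|V|, 4).
Proof.
suff E : #|four_cycles| * 2 = #|disjoint_pairs|.
  have := mul_bin_left #|V| 3; have := mul_bin_left #|V| 2.
  have := mul_bin_left (#|V| - 2) 1; rewrite bin1.
  by move: E; rewrite card_disjoint_pairs; nia.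
rewrite -sum_nat_const -[RHS]sum1_card.
rewrite (partition_big (fun p => biclique p.1 p.2) (mem four_cycles)) /=;
  last first.
  by move=> p pD; apply: imset_f.
apply: eq_bigr => _ /imsetP[p pD ->]; rewrite sum1dep_card.
have swD : (p.2, p.1) \in disjoint_pairs.
  by move: pD; rewrite !inE /= disjoint_sym andbCA.
rewrite (_ : [set q | _] = [set p; (p.2, p.1)]).
  rewrite cards2; case: eqP => // pE.
  move: pD; rewrite inE pE /=; move: pE; case: p {swD} => x y /= [-> _].
  by rewrite inE => /and3P[/eqP yc _]; rewrite -setI_eq0 setIid -cards_eq0 yc.
apply/setP=> q; rewrite in_set in_set2; apply/andP/orP => [[qD /eqP E]|].
  by case: (biclique_inj pD qD (esym E)) => ->; rewrite eqxx; [left|right].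
case=> /eqP->; split=> //=; apply/eqP/setP => e; apply/imset2P/imset2P;
  by case=> x y x1 y1 ->; exists y x => //; rewrite setUC.
Qed.

(** * Triangles, and small graphs without leaves *)

Definition triples : {set {set V}} := [set A : {set V} | #|A| == 3].

Definition clique A := [set e in pairs | e \subset A].

Lemma card_clique A : A \in triples -> #|clique A| = 3.
Proof.
rewrite inE => /eqP A3; rewrite -[RHS]/'C(3, 2) -A3 -cards_draws.
by apply: eq_card => e; rewrite !inE andbC.
Qed.

Lemma clique_pairs A : clique A \subset pairs.
Proof. by apply/fintype.subsetP => e; rewrite inE => /andP[]. Qed.

Lemma clique_set2 A a b :
  ([set a; b] \in clique A) = [&& a != b, a \in A & b \in A].
Proof. by rewrite inE set2_pairs subUset !sub1set. Qed.

Lemma triplesP A :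
  reflect (exists a b c, [/\ a != b, b != c, a != c & A = [set a; b; c]])
    (A \in triples).
Proof.
rewrite inE; apply: (iffP eqP) => [A3|].
  have [a aA] : exists a, a \in A by apply/set0Pn; rewrite -card_gt0 A3.
  move: A3; rewrite (cardsD1 a) aA => -[/eqP/cards2P[b [c [bc E]]]].
  have ne x : x \in A :\ a -> a != x by rewrite !inE eq_sym => /andP[].
  exists a, b, c; rewrite bc !ne ?E ?inE ?eqxx ?orbT //; split=> //.
  by rewrite -[LHS](setD1K aA) E setUA.
case=> [a [b [c [ab bc ac ->]]]].
by rewrite -setUA cardsU1 cards2 !inE bc negb_or ab ac.
Qed.

Lemma clique_triangle A : A \in triples -> has_triangle (clique A).
Proof.
case/triplesP=> [a [b [c [ab bc ac ->]]]]; apply/has_triangleP; exists a, b, c.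
by rewrite !clique_set2 !inE ab bc ac !eqxx ?orbT.
Qed.

Lemma triangle_clique S : S \subset pairs -> has_triangle S ->
  exists2 A, A \in triples & clique A \subset S.
Proof.
move=> /fintype.subsetP SP /has_triangleP[a [b [c [abS bcS acS]]]].
exists [set a; b; c].
  by apply/triplesP; exists a, b, c; rewrite -!set2_pairs !SP.
apply/fintype.subsetP => e; rewrite !inE => /andP[/cards2P[x [y [xy ->]]]].
rewrite subUset !sub1set !inE -!orbA => /andP[xA yA].
case/or3P: xA xy => /eqP-> xy; case/or3P: yA xy => /eqP->; rewrite ?eqxx // => _;
  by rewrite // setUC.
Qed.

Lemma clique_inj : {in triples &, injective clique}.
Proof.
suff H A B : A \in triples -> clique A = clique B -> A \subset B.
  by move=> A B At Bt E; apply/eqP; rewrite eqEsubset !H.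
case/triplesP=> [a [b [c [ab bc ac AE]]]] E; apply/fintype.subsetP.
have := clique_set2 B a b; have := clique_set2 B b c.
rewrite -E !clique_set2 AE !inE !eqxx ab bc /= !orbT /=.
by move=> /esym/andP[bB cB] /esym/andP[aB _] x /setUP[/setUP[]|] /set1P->.
Qed.

(** Follow a walk [a], [b], [c], [d], [f] that never turns back. The absence of triangles gives
    [d != a] and [f != b], so its four edges are distinct. If there are no others, then [f = a],
    since the walk would otherwise go on to a fifth edge; the diagonals are then [a], [c] and [b],
    [d]. *)
Lemma leafless_card S : S \subset pairs -> ~~ has_triangle S -> ~~ has_leaf S ->
  S != set0 -> 4 <= #|S| /\ (#|S| = 4 -> S \in four_cycles).
Proof.
move=> SP ntr nl /set0Pn[e eS].
have tr x y z : [set x; y] \in S -> [set y; z] \in S -> [set x; z] \notin S.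
  by move=> h1 h2; apply: contra ntr => h3; apply/has_triangleP; exists x, y, z.
have ne x y : [set x; y] \in S -> x != y.
  by rewrite -set2_pairs => /(fintype.subsetP SP).
have nx x y := @leafless_next S x y SP nl.
have size_le (s : seq {set V}) : uniq s -> all (mem S) s -> size s <= #|S|.
  by move=> us /allP sS; rewrite -(card_uniqP us);
    apply/subset_leq_card/fintype.subsetP.
have [a [b [ab eE]]] : exists a b, a != b /\ e = [set a; b].
  by apply/cards2P; have := fintype.subsetP SP _ eS; rewrite inE.
rewrite {e}eE in eS.
have [c ca bcS] := nx _ _ eS; have bc := ne _ _ bcS.
have [d db cdS] := nx _ _ bcS; have cd := ne _ _ cdS.
have da : d != a.
  by apply: contraTneq cdS => ->; rewrite setUC; apply: tr eS bcS.
have [f fc dfS] := nx _ _ cdS; have df := ne _ _ dfS.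
have fb : f != b.
  by apply: contraTneq dfS => ->; rewrite setUC; apply: tr bcS cdS.
have sy (x y : V) : x != y -> ((x == y) = false) * ((y == x) = false).
  by move=> /negbTE xy; split; last rewrite eq_sym.
have N := (sy _ _ (ne _ _ eS), sy _ _ bc, sy _ _ cd, sy _ _ df, sy _ _ ca,
  sy _ _ db, sy _ _ da, sy _ _ fc, sy _ _ fb).
split.
  apply: (size_le [:: [set a; b]; [set b; c]; [set c; d]; [set d; f]]).
    by rewrite /= !inE !eq_set2 !N /= ?andbF.
  by rewrite /= eS bcS cdS dfS.
move=> S4.
have fa : f = a.
  apply/eqP/negPn/negP => fa.
  have [g gd fgS] := nx _ _ dfS; have fg := ne _ _ fgS.
  have : 5 <= #|S|; last by rewrite S4.
  apply: (size_le
    [:: [set a; b]; [set b; c]; [set c; d]; [set d; f]; [set f; g]]); last first.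
    by rewrite /= eS bcS cdS dfS fgS.
  by rewrite /= !inE !eq_set2 !N !(sy _ _ fa, sy _ _ fg, sy _ _ gd) /= ?andbF.
subst f.
have dis : [disjoint [set a; c] & [set b; d]].
  rewrite -setI_eq0; apply/eqP/setP => x; rewrite !inE; apply/negP.
  by case/andP=> /orP[]/eqP-> /orP[]/eqP; apply/eqP;
    rewrite // 1?eq_sym //; exact: ne.
apply/imsetP; exists ([set a; c], [set b; d]).
  by rewrite inE !set2_pairs dis !N.
apply/esym/eqP; rewrite eqEcard S4 card_biclique // !cards2 !N andbT.
apply/fintype.subsetP => _ /imset2P[x y + + ->]; rewrite !inE.
by move=> /orP[]/eqP-> /orP[]/eqP-> //; rewrite setUC.
Qed.
End EdgeSets.

(** * Colorings and their conflicts *)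

Lemma leq_sum_imset (I J : finType) (D : {set I}) (h : I -> J) (F : J -> nat) :
  \sum_(j in h @: D) F j <= \sum_(i in D) F (h i).
Proof.
rewrite [leqRHS](partition_big h (mem (h @: D))) /=; last first.
  by move=> i iD; apply: imset_f.
apply: leq_sum => _ /imsetP[i iD ->].
by rewrite (bigD1 i) ?iD ?eqxx //= leq_addr.
Qed.

(** For [k > 0] the alternating sum of the ['C(k, i)] up to [i = 4] is ['C(k - 1, 4)], and up to
    [i = 5] it is minus ['C(k - 1, 5)]; this gives both Bonferroni inequalities. Negative terms are
    moved across to stay in the natural numbers. *)
Lemma bin_bonferroni4 k :
  (k == 0) + k + 'C(k, 3) <= 1 + 'C(k, 2) + 'C(k, 4).
Proof. by case: k => // k; rewrite !binS bin1 /=; lia. Qed.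

Lemma bin_bonferroni5 k :
  1 + 'C(k, 2) + 'C(k, 4) <= (k == 0) + k + 'C(k, 3) + 'C(k, 5).
Proof. by case: k => // k; rewrite !binS bin1 /=; lia. Qed.

Section Colorings.
Variables (V C : finType) (s : V -> V -> C -> C).
Hypothesis sK : forall u v, u != v -> cancel (s u v) (s v u).
Implicit Types (u v : V) (A : {set V}) (S : {set {set V}}) (f : {ffun V -> C}).
Local Notation n := #|V|.
Local Notation m := #|C|.

(** [s u v] sends a color of [u] to the color of [v] matched with it. A pair is unordered, so both
    orders are tested; they agree because [s u v] and [s v u] are inverse. *)
Definition conflicts f : {set {set V}} :=
  [set e in pairs V |
    [forall u in e, forall v in e, (u != v) ==> (f v == s u v (f u))]].

Lemma conflicts_set2 f u v :
  u != v -> ([set u; v] \in conflicts f) = (f v == s u v (f u)).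
Proof.
move=> uv; rewrite inE set2_pairs uv /=; apply/forall_inP/eqP => [/(_ u)|E x].
  rewrite !inE eqxx => /(_ isT) /forall_inP/(_ v).
  by rewrite !inE eqxx orbT uv => /(_ isT) /= /eqP.
rewrite !inE => /orP[]/eqP->; apply/forall_inP => y; rewrite !inE;
  move=> /orP[]/eqP->; rewrite ?eqxx ?uv //= ?E ?eqxx //.
by rewrite eq_sym uv /= sK.
Qed.

Lemma conflicts_pairs f : conflicts f \subset pairs V.
Proof. by apply/fintype.subsetP => e; rewrite inE => /andP[]. Qed.

(** The quantity N(S), with transversals viewed as colorings. *)
Definition nconf S := #|[set f | S \subset conflicts f]|.

Lemma nconf_sub S1 S2 : S1 \subset S2 -> nconf S2 <= nconf S1.
Proof.
move=> sub; apply/subset_leq_card/fintype.subsetP => f; rewrite !inE.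
exact: fintype.subset_trans.
Qed.

Lemma nconf_set0 : nconf set0 = m ^ n.
Proof.
by rewrite -card_ffun -cardsT; apply: eq_card => f; rewrite !inE sub0set.
Qed.

(** The edge at the leaf forces the color of [v] from that of [u]; once it is deleted, the color of
    [v] is free. *)
Lemma nconf_leaf S u v : S \subset pairs V -> leaf S u v ->
  nconf (S :\ [set u; v]) = nconf S * m.
Proof.
move=> SP /and3P[uv uvS /forall_inP lf].
(* The bijection overwrites the color at [v] by an arbitrary one. *)
pose upd (p : {ffun V -> C} * C) := [ffun x => if x == v then p.2 else p.1 x].
have conf f (g : {ffun V -> C}) (e : {set V}) : {in predC1 v, f =1 g} ->
    v \notin e ->
    (e \in conflicts f) = (e \in conflicts g).
  move=> fg ve; rewrite !inE; congr (_ && _).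
  apply: eq_forallb_in => x xe; apply: eq_forallb_in => y ye.
  by rewrite !fg // inE; apply: contraNneq ve => <-.
have sub f (g : {ffun V -> C}) : {in predC1 v, f =1 g} ->
    (S :\ [set u; v] \subset conflicts f) = (S :\ [set u; v] \subset conflicts g).
  move=> fg; have E (e : {set V}) :
      e \in S :\ [set u; v] -> (e \in conflicts f) = (e \in conflicts g).
    rewrite in_setD1 => /andP[e_uv eS]; apply: conf => //.
    by apply: contra e_uv => ve; have := lf _ eS; rewrite ve.
  by apply/fintype.subsetP/fintype.subsetP => H e eS; have := H e eS; rewrite E.
rewrite -[m]cardsT -cardsX -(card_in_imset (f := upd)); last first.
  move=> [f x] [g y]; rewrite !inE !andbT => fS gS /ffunP E.
  have fg w : w != v -> f w = g w.
    by move=> wv; have := E w; rewrite !ffunE (negbTE wv).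
  have -> : x = y by have := E v; rewrite !ffunE eqxx.
  congr (_, _); apply/ffunP => w; have [->|/fg//] := eqVneq w v.
  have := fintype.subsetP fS _ uvS; have := fintype.subsetP gS _ uvS.
  by rewrite !conflicts_set2 // => /eqP-> /eqP->; rewrite fg.
apply: eq_card => g; rewrite inE; apply/idP/imsetP => [gS|[[f x]]]; last first.
  rewrite !inE andbT => fS ->; rewrite (sub _ f).
    by apply: fintype.subset_trans fS; apply: subD1set.
  by move=> w; rewrite inE ffunE => /negbTE->.
(* The preimage restores the forced color at [v] and stores the color that [g] has there. *)
exists ([ffun x => if x == v then s u v (g u) else g x], g v); last first.
  by apply/ffunP=> x; rewrite !ffunE; case: eqP => // ->.
rewrite !inE andbT -(setD1K uvS) subUset sub1set.
rewrite conflicts_set2 // !ffunE eqxx (negbTE uv) eqxx /= (sub _ g) //.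
by move=> w; rewrite inE ffunE => /negbTE->.
Qed.

Lemma card_extensions A (g : V -> C) :
  #|[set f : {ffun V -> C} | [forall v in A, f v == g v]]| = m ^ (n - #|A|).
Proof.
pose F v : pred C := if v \in A then pred1 (g v) else predT.
rewrite (eq_card (B := family F)) => [|f]; last first.
  rewrite inE; apply/forall_inP/familyP => [H v|H v vA].
    by rewrite /F; case: ifP => // /H.
  by have := H v; rewrite /F vA.
rewrite card_family foldrE big_map big_enum /=.
rewrite (bigID (mem A)) /= big1 => [|v vA]; last by rewrite /F vA card1.
rewrite mul1n (eq_bigr (fun=> m)) => [|v /negbTE vA]; last by rewrite /F vA.
by rewrite prod_nat_const -(cardsC A) addKn; congr (_ ^ _);
  apply: eq_card => v; rewrite !inE.
Qed.

(** Leaves are deleted one at a time. [leafless_card] supplies a leaf at each stage, and after the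
    first deletion too few edges remain for a 4-cycle. *)
Lemma nconf_forest S : S \subset pairs V -> ~~ has_triangle S -> #|S| <= 4 ->
  S \notin four_cycles V -> nconf S * m ^ #|S| = m ^ n.
Proof.
move Sk : #|S| => k; elim: k S Sk => [|k IHk] S Sk SP ntr k4 nC.
  by move/eqP: Sk; rewrite cards_eq0 => /eqP->; rewrite nconf_set0 muln1.
have Sn0 : S != set0 by rewrite -cards_eq0 Sk.
have [|nl] := boolP (has_leaf S); last first.
  have [h4 hC] := leafless_card SP ntr nl Sn0.
  by rewrite hC // in nC; apply/eqP; rewrite eqn_leq h4 Sk k4.
case/existsP=> u /existsP[v lf]; have /and3P[uv uvS _] := lf.
have S'k : #|S :\ [set u; v]| = k.
  by move: Sk; rewrite (cardsD1 [set u; v]) uvS => -[].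
rewrite expnS mulnA -(nconf_leaf SP lf) IHk //.
- by apply: fintype.subset_trans SP; apply: subD1set.
- by apply: contra ntr; apply: has_triangleS; apply: subD1set.
- exact: ltnW.
- by apply/negP => /four_cycles_card; rewrite S'k => k4'; rewrite k4' in k4.
Qed.

(** Covers 4-cycles too: deleting any edge leaves a three-edge forest and can only increase
    [nconf]. *)
Lemma nconf_card4 S : S \subset pairs V -> ~~ has_triangle S -> #|S| = 4 ->
  nconf S * m ^ 3 <= m ^ n.
Proof.
move=> SP ntr S4; have [e eS] : exists e, e \in S.
  by apply/set0Pn; rewrite -cards_eq0 S4.
have S3 : #|S :\ e| = 3 by move: S4; rewrite (cardsD1 e) eS => -[].
rewrite -(@nconf_forest (S :\ e)) ?S3 //.
- by rewrite leq_mul2r nconf_sub ?orbT // subD1set.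
- by apply: fintype.subset_trans SP; apply: subD1set.
- by apply: contra ntr; apply: has_triangleS; apply: subD1set.
- by apply/negP => /four_cycles_card; rewrite S3.
Qed.

(** Delete any edge [e]. If a 4-cycle remains, then [e] is not one of its diagonals, as that would
    create a triangle; so [e] ends in a leaf, whose factor of the number of colors improves the
    bound of [nconf_card4]. *)
Lemma nconf_card5 S : S \subset pairs V -> ~~ has_triangle S -> #|S| = 5 ->
  nconf S * m ^ 4 <= m ^ n.
Proof.
move=> SP ntr S5; have [e eS] : exists e, e \in S.
  by apply/set0Pn; rewrite -cards_eq0 S5.
have S4 : #|S :\ e| = 4 by move: S5; rewrite (cardsD1 e) eS => -[].
have S'P : S :\ e \subset pairs V.
  by apply: fintype.subset_trans SP; apply: subD1set.
have ntr' : ~~ has_triangle (S :\ e).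
  by apply: contra ntr; apply: has_triangleS; apply: subD1set.
have [S'C|S'C] := boolP (S :\ e \in four_cycles V); last first.
  rewrite -(@nconf_forest (S :\ e)) ?S4 //.
  by rewrite leq_mul2r nconf_sub ?orbT // subD1set.
suff [u [v [eE lf]]] : exists u v, e = [set u; v] /\ leaf S u v.
  by rewrite expnS mulnA -(nconf_leaf SP lf) -eE nconf_card4.
case/imsetP: S'C => -[p q] /=; rewrite !inE => /and3P[/= p2 q2 dis] S'E.
have := fintype.subsetP SP _ eS; rewrite inE => /cards2P[u [v [uv eE]]].
have lfx x y : e = [set x; y] -> x != y -> y \notin p -> y \notin q -> leaf S x y.
  move=> exy xy yp yq; rewrite /leaf xy -exy eS /=; apply/forall_inP => e' e'S.
  apply/implyP => ye'; apply: contraT => ne'.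
  have : e' \in S :\ e by rewrite !inE ne'.
  rewrite S'E => /imset2P[a b ap bq e'E]; move: ye'; rewrite e'E !inE.
  by case/orP=> /eqP ye; [rewrite ye ap in yp | rewrite ye bq in yq].
have [|] := boolP ((v \notin p) && (v \notin q)).
  by case/andP=> *; exists u, v; split; rewrite // lfx.
have [|] := boolP ((u \notin p) && (u \notin q)).
  case/andP=> *; exists v, u; rewrite setUC; split; rewrite // lfx //.
    by rewrite setUC.
  by rewrite eq_sym.
rewrite !negb_and !negbK => upq vpq; exfalso.
have in_S x y : ([set x; y] \in S) =
    ([set x; y] == e) || (x \in p) && (y \in q) || (x \in q) && (y \in p).
  by rewrite -(setD1K eS) in_setU1 S'E biclique_set2 orbA.
have eN : e \notin biclique p q by rewrite -S'E !inE eqxx.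
move: eN; rewrite eE biclique_set2 => eN.
have [x xp] : exists x, x \in p by apply/set0Pn; rewrite -cards_eq0 (eqP p2).
have [y yq] : exists y, y \in q by apply/set0Pn; rewrite -cards_eq0 (eqP q2).
move/negP: ntr; apply; apply/has_triangleP.
(* Ends on opposite sides would make [e] an edge of the cycle; ends on the same side form a triangle
   with any vertex of the other side. *)
case/orP: upq eN => [up|uq]; case/orP: vpq => [vp|vq];
  rewrite ?up ?uq ?vp ?vq ?orbT //= => _.
- by exists u, v, y; rewrite !in_S -eE eqxx up vp yq ?orbT.
- by exists u, v, x; rewrite !in_S -eE eqxx uq vq xp ?orbT.
Qed.

(** Such an edge has an end outside [A], and that end is a leaf. *)
Lemma nconf_triangle_edge A e : e \in pairs V -> e \notin clique A ->
  nconf (e |: clique A) * m = nconf (clique A).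
Proof.
move=> eP eA; have := eP; rewrite inE => /cards2P[x [y [xy eE]]].
wlog yA : x y xy eE / y \notin A.
  move=> H; have [yA|/(H x y)->//] := boolP (y \in A).
  rewrite (H y x) // 1?eq_sym // 1?setUC //.
  by move: eA; rewrite eE clique_set2 xy yA andbT.
have E : (e |: clique A) :\ [set x; y] = clique A by rewrite -eE setU1K.
rewrite -[in RHS]E nconf_leaf //.
  by rewrite subUset sub1set eP clique_pairs.
rewrite /leaf xy -eE setU11; apply/forall_inP => e'; rewrite in_setU1.
case/orP=> [->|]; rewrite ?implybT // inE => /andP[_ /fintype.subsetP e'A].
by apply/implyP => /e'A yA'; rewrite yA' in yA.
Qed.

(** Double counting of the pairs of a coloring and a set of [k] of its conflicts. *)
Lemma sum_bin_conflicts k :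
  \sum_f 'C(#|conflicts f|, k)
  = \sum_(S : {set {set V}} | (S \subset pairs V) && (#|S| == k)) nconf S.
Proof.
under eq_bigr => f _ do rewrite -cards_draws -sum1dep_card big_mkcond.
rewrite exchange_big /= [RHS]big_mkcond; apply: eq_bigr => S _ /=.
rewrite -big_mkcond /= sum1dep_card /nconf.
case: ifP => [/andP[SP ->]|SPk]; first by apply: eq_card => f; rewrite !inE andbT.
apply: eq_card0 => f; rewrite !inE; apply: contraFF SPk => /andP[SC ->].
by rewrite andbT; apply: fintype.subset_trans SC (conflicts_pairs f).
Qed.

(** * Bonferroni inequalities for the number of proper colorings *)

Definition proper_count := #|[set f | conflicts f == set0]|.

Local Notation Sum k :=
  (\sum_(S : {set {set V}} | (S \subset pairs V) && (#|S| == k)) nconf S).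

Lemma sum_bin0 : \sum_f 'C(#|conflicts f|, 0) = m ^ n.
Proof.
by under eq_bigr => f _ do rewrite bin0; rewrite sum1_card card_ffun.
Qed.

Lemma proper_countE : proper_count = \sum_f (#|conflicts f| == 0).
Proof.
rewrite /proper_count -sum1dep_card big_mkcond; apply: eq_bigr => f _.
by rewrite cards_eq0; case: eqP.
Qed.

Lemma bonferroni_upper :
  proper_count + Sum 1 + Sum 3 <= m ^ n + Sum 2 + Sum 4.
Proof.
rewrite -sum_bin0 proper_countE -!sum_bin_conflicts -!big_split /=.
by apply: leq_sum => f _; rewrite bin0 bin1 bin_bonferroni4.
Qed.

Lemma bonferroni_lower :
  m ^ n + Sum 2 + Sum 4 <= proper_count + Sum 1 + Sum 3 + Sum 5.
Proof.
rewrite -sum_bin0 proper_countE -!sum_bin_conflicts -!big_split /=.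
by apply: leq_sum => f _; rewrite bin0 bin1 bin_bonferroni5.
Qed.

End Colorings.

(** * Bounds from the Bonferroni inequalities *)

Section CountingBounds.
Variables (V C : finType) (s : V -> V -> C -> C).
Hypothesis sK : forall u v, u != v -> cancel (s u v) (s v u).
Hypothesis V4 : 4 <= #|V|.
Hypothesis C0 : 0 < #|C|.
Implicit Types (u v : V) (A : {set V}) (S : {set {set V}}) (f : {ffun V -> C}).
Local Notation n := #|V|.
Local Notation m := #|C|.
Local Notation t := 'C(#|V|, 2).
Local Notation Sum k :=
  (\sum_(S : {set {set V}} | (S \subset pairs V) && (#|S| == k)) nconf s S).

Lemma card_edge_sets k :
  #|[set S : {set {set V}} | (S \subset pairs V) && (#|S| == k)]| = 'C(t, k).
Proof. by rewrite cards_draws card_pairs. Qed.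

Lemma nconf_forestE S : S \subset pairs V -> ~~ has_triangle S -> #|S| <= 4 ->
  S \notin four_cycles V -> nconf s S = m ^ (n - #|S|).
Proof.
move=> SP ntr S4 nC; have := nconf_forest sK SP ntr S4 nC.
rewrite -{1}(subnK (leq_trans S4 V4)) expnD => /eqP.
by rewrite eqn_pmul2r ?expn_gt0 ?C0 // => /eqP.
Qed.

Lemma has_triangle_card S : S \subset pairs V -> has_triangle S -> 3 <= #|S|.
Proof.
move=> SP /(triangle_clique SP)[A At /subset_leq_card].
by rewrite card_clique.
Qed.

Lemma sum_small k : k <= 2 -> Sum k = 'C(t, k) * m ^ (n - k).
Proof.
move=> k2; rewrite -card_edge_sets -sum_nat_const.
rewrite [RHS](eq_bigl (fun S => (S \subset pairs V) && (#|S| == k))) => [|S];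
  last by rewrite inE.
apply: eq_bigr => S /andP[SP /eqP Sk]; rewrite -Sk nconf_forestE //.
- by apply/negP => /(has_triangle_card SP); rewrite Sk leqNgt ltnS k2.
- by rewrite Sk; apply: leq_trans k2 _.
- by apply/negP => /four_cycles_card; rewrite Sk => E; rewrite E in k2.
Qed.

Lemma sum_over_triangles (F : {set {set V}} -> nat) :
  \sum_(S : {set {set V}} |
        [&& S \subset pairs V, #|S| == 3 & has_triangle S]) F S
  = \sum_(A in triples V) F (clique A).
Proof.
rewrite -(big_imset F (@clique_inj V)); apply: eq_bigl => S.
apply/and3P/imsetP => [[SP /eqP S3 Str]|[A At ->]]; last first.
  by rewrite clique_pairs card_clique // clique_triangle.
have [A At AS] := triangle_clique SP Str; exists A => //.
by apply/esym/eqP; rewrite eqEcard AS card_clique // S3.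
Qed.

Lemma card_triples : #|triples V| = 'C(n, 3).
Proof. exact: card_draws. Qed.

Definition triangle_count := \sum_(A in triples V) nconf s (clique A).

(** Among the three-edge sets only the ['C(n, 3)] triangles escape the forest formula. *)
Lemma sum3 :
  Sum 3 + 'C(n, 3) * m ^ (n - 3) = triangle_count + 'C(t, 3) * m ^ (n - 3).
Proof.
have split F : \sum_(S : {set {set V}} | (S \subset pairs V) && (#|S| == 3)) F S
  = \sum_(A in triples V) F (clique A) +
    \sum_(S : {set {set V}} |
       [&& S \subset pairs V, #|S| == 3 & ~~ has_triangle S]) F S :> nat.
  rewrite (bigID (@has_triangle V)) /= -sum_over_triangles.
  by congr (_ + _); apply: eq_bigl => S; rewrite andbA.
have -> : 'C(t, 3) * m ^ (n - 3) =
    \sum_(S : {set {set V}} | (S \subset pairs V) && (#|S| == 3)) m ^ (n - 3).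
  by rewrite -card_edge_sets -sum_nat_const; apply: eq_bigl => S; rewrite inE.
rewrite !split sum_nat_const card_triples -addnA; congr (_ + _).
rewrite addnC; congr (_ + _); apply: eq_bigr => S /and3P[SP /eqP S3 ntr].
rewrite nconf_forestE ?S3 //.
by apply/negP => /four_cycles_card; rewrite S3.
Qed.

Definition triangle_edge_count :=
  \sum_(S : {set {set V}} |
      [&& S \subset pairs V, #|S| == 4 & has_triangle S]) nconf s S.

(** Each triangle can be completed by [t - 3] further edges, and each completion divides its count
    by [m]. *)
Lemma triangle_edge_bound : triangle_edge_count * m <= triangle_count * (t - 3).
Proof.
pose D := [set p : {set V} * {set V} |
  (p.1 \in triples V) && (p.2 \in pairs V :\: clique p.1)].
(* It suffices that every set counted on the left is a triangle together with one more edge. *)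
have le : triangle_edge_count <= \sum_(p in D) nconf s (p.2 |: clique p.1).
  apply: leq_trans (leq_sum_imset D (fun p => p.2 |: clique p.1) (nconf s)).
  rewrite [leqRHS](bigID (fun S =>
    [&& S \subset pairs V, #|S| == 4 & has_triangle S])) /=.
  apply: leq_trans (leq_addr _ _); rewrite leq_eqVlt; apply/orP; left.
  apply/eqP/eq_bigl => S; apply/idP/andP => [h|[] //]; split=> //.
  case/and3P: h => SP /eqP S4 /(triangle_clique SP)[A At AS].
  have /cards1P[e eE] : #|S :\: clique A| == 1.
    by rewrite cardsD (setIidPr AS) S4 card_clique.
  have : e \in S :\: clique A by rewrite eE set11.
  rewrite in_setD => /andP[eA eS]; apply/imsetP; exists (A, e).
    by rewrite inE /= At in_setD eA (fintype.subsetP SP).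
  by rewrite /= -eE setUC -{1}(setIidPr AS) setID.
apply: leq_trans (leq_mul le (leqnn m)) _.
rewrite big_distrl /= /triangle_count big_distrl /=.
rewrite (eq_bigl (fun p : {set V} * {set V} =>
  (p.1 \in triples V) && (p.2 \in pairs V :\: clique p.1))) => [|p];
  last by rewrite inE.
rewrite -(pair_big_dep (fun A => A \in triples V)
  (fun A e => e \in pairs V :\: clique A)
  (fun A e => nconf s (e |: clique A) * m)) /=.
apply: leq_sum => A At; rewrite (eq_bigr (fun=> nconf s (clique A))); last first.
  by move=> e; rewrite in_setD => /andP[eA eP]; rewrite nconf_triangle_edge.
rewrite sum_nat_const mulnC cardsD card_pairs.
by rewrite (setIidPr (clique_pairs A)) card_clique.
Qed.

Lemma four_cycle_sum (F : {set {set V}} -> nat) :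
  \sum_(S : {set {set V}} | [&& S \subset pairs V, #|S| == 4 & ~~ has_triangle S]
      && (S \in four_cycles V)) F S = \sum_(S in four_cycles V) F S.
Proof.
apply: eq_bigl => S; apply/andP/idP => [[]//|SC]; split=> //.
by rewrite four_cycles_pairs // four_cycles_card // four_cycles_triangle.
Qed.

Lemma sum4_split : Sum 4 = triangle_edge_count +
  (\sum_(S in four_cycles V) nconf s S +
   \sum_(S : {set {set V}} | [&& S \subset pairs V, #|S| == 4 & ~~ has_triangle S]
      && (S \notin four_cycles V)) nconf s S).
Proof.
rewrite (bigID (@has_triangle V)) /= /triangle_edge_count -four_cycle_sum.
congr (_ + _); first by apply: eq_bigl => S; rewrite andbA.
rewrite (bigID (mem (four_cycles V))) /=.
by congr (_ + _); apply: eq_bigl => S; rewrite andbA.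
Qed.

Lemma sum_const_le (P : pred {set {set V}}) k x :
  (forall S, P S -> (S \subset pairs V) && (#|S| == k)) ->
  \sum_(S | P S) x <= 'C(t, k) * x.
Proof.
move=> PS; rewrite sum_nat_const leq_mul2r -card_edge_sets; apply/orP; right.
by apply/subset_leq_card/fintype.subsetP => S /PS; rewrite inE.
Qed.

Lemma expn_pmul_le k x : k <= 4 -> x * m ^ k <= m ^ n -> x <= m ^ (n - k).
Proof.
move=> k4; rewrite -[in m ^ n](subnK (leq_trans k4 V4)) expnD.
by rewrite leq_pmul2r // expn_gt0 C0.
Qed.

(** Each of the [3 * 'C(n, 4)] 4-cycles contributes at most [m ^ (n - 3)]; the remaining
    triangle-free sets are forests. *)
Lemma sum4_upper : Sum 4 <= triangle_edge_count +
  3 * 'C(n, 4) * m ^ (n - 3) + 'C(t, 4) * m ^ (n - 4).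
Proof.
rewrite sum4_split -addnA leq_add2l leq_add //.
  rewrite -card_four_cycles -sum_nat_const; apply: leq_sum => S SC.
  apply: expn_pmul_le => //; apply: (nconf_card4 sK).
  - exact: four_cycles_pairs.
  - exact: four_cycles_triangle.
  - exact: four_cycles_card.
apply: (@leq_trans (\sum_(S : {set {set V}} |
    [&& S \subset pairs V, #|S| == 4 & ~~ has_triangle S]
      && (S \notin four_cycles V)) m ^ (n - 4))).
  apply: leq_sum => S /andP[/and3P[SP /eqP S4 ntr] nC].
  by rewrite nconf_forestE ?S4.
by apply: sum_const_le => S /andP[/and3P[-> ->]].
Qed.

Lemma proper_count_upper :
  proper_count s + t * m ^ (n - 1) + 'C(t, 3) * m ^ (n - 3) + triangle_count
  <= m ^ n + 'C(t, 2) * m ^ (n - 2) + 'C(n, 3) * m ^ (n - 3)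
     + 3 * 'C(n, 4) * m ^ (n - 3) + 'C(t, 4) * m ^ (n - 4)
     + triangle_edge_count.
Proof.
have := bonferroni_upper s; have := sum4_upper; have := sum3.
by rewrite (@sum_small 1) // (@sum_small 2) // bin1; lia.
Qed.

(** Coloring [u], [v], [w] by the corners of the triangle leaves the other vertices free. *)
Lemma triangle_count_lower u v w x :
  u != v -> v != w -> u != w -> s v w (s u v x) = s u w x ->
  m ^ (n - 3) <= triangle_count.
Proof.
move=> uv vw uw tri; pose A := [set u; v; w].
have At : A \in triples V by apply/triplesP; exists u, v, w.
rewrite /triangle_count (bigD1 A) //=; apply: leq_trans (leq_addr _ _).
pose g y := if y == u then x else s u y x.
have -> : 3 = #|A| by apply/esym/eqP; move: At; rewrite inE.
rewrite -(card_extensions A g).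
apply/subset_leq_card/fintype.subsetP => f; rewrite !inE => /forall_inP fg.
have fu : f u = x by rewrite (eqP (fg u _)) /g ?eqxx // !inE eqxx.
have fv : f v = s u v x.
  by rewrite (eqP (fg v _)) /g 1?eq_sym ?(negbTE uv) // !inE eqxx orbT.
have fw : f w = s u w x.
  by rewrite (eqP (fg w _)) /g 1?eq_sym ?(negbTE uw) // !inE eqxx orbT.
apply/fintype.subsetP => e; rewrite inE => /andP[].
rewrite inE => /cards2P[a [b [ab ->]]].
rewrite subUset !sub1set !in_setU !in_set1 -!orbA.
have h1 : [set u; v] \in conflicts s f by rewrite conflicts_set2 // fu fv.
have h2 : [set v; w] \in conflicts s f by rewrite conflicts_set2 // fv fw tri.
have h3 : [set u; w] \in conflicts s f by rewrite conflicts_set2 // fu fw.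
case/andP=> aA bA.
case/or3P: aA ab => /eqP-> ab; case/or3P: bA ab => /eqP->; rewrite ?eqxx // => _;
  by rewrite // setUC.
Qed.

(** * Lower bound when the cover graph has no triangle *)

Section TriangleFree.
Hypothesis no_triangle : forall u v w x,
  u != v -> v != w -> u != w -> s v w (s u v x) != s u w x.

Lemma nconf_triangle S : S \subset pairs V -> has_triangle S -> nconf s S = 0.
Proof.
move=> /fintype.subsetP SP /has_triangleP[u [v [w [uvS vwS uwS]]]].
have [uv vw uw] : [/\ u != v, v != w & u != w] by rewrite -!set2_pairs !SP.
apply: eq_card0 => f; rewrite !inE; apply/negP => /fintype.subsetP SC.
have := no_triangle (f u) uv vw uw; case/eqP.
have := SC _ uvS; have := SC _ vwS; have := SC _ uwS.
by rewrite !conflicts_set2 // => /eqP <- /eqP -> /eqP <-.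
Qed.

Lemma sum5_upper : Sum 5 <= 'C(t, 5) * m ^ (n - 4).
Proof.
apply: (@leq_trans (\sum_(S : {set {set V}} |
    (S \subset pairs V) && (#|S| == 5)) m ^ (n - 4))); last exact: sum_const_le.
apply: leq_sum => S /andP[SP /eqP S5].
have [str|ntr] := boolP (has_triangle S); first by rewrite nconf_triangle.
by apply: expn_pmul_le => //; apply: (nconf_card5 sK).
Qed.

(** Of the four-edge sets only the 4-cycles are kept; the forests are dropped, as they add only
    order [m ^ (n - 4)]. *)
Lemma proper_count_lower k :
  (forall S, S \in four_cycles V -> k <= nconf s S) ->
  m ^ n + 'C(t, 2) * m ^ (n - 2) + 'C(n, 3) * m ^ (n - 3) + 3 * 'C(n, 4) * k
  <= proper_count s + t * m ^ (n - 1) + 'C(t, 3) * m ^ (n - 3)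
     + 'C(t, 5) * m ^ (n - 4).
Proof.
move=> kC; have := bonferroni_lower s; have := sum5_upper; have := sum3.
have : 3 * 'C(n, 4) * k <= Sum 4.
  rewrite sum4_split addnC -addnA; apply: leq_trans (leq_addr _ _).
  by rewrite -card_four_cycles -sum_nat_const; apply: leq_sum.
have -> : triangle_count = 0.
  by apply: big1 => A At; rewrite nconf_triangle ?clique_pairs ?clique_triangle.
by rewrite (@sum_small 1) // (@sum_small 2) // bin1; lia.
Qed.

End TriangleFree.
End CountingBounds.

(** * Covers as systems of bijections *)

Section CoverFacts.
Variables (G : sgraph) (HH : dp_cover G).
Local Notation H := (cover_graph HH).
Local Notation L := (@cover_list G HH).

(** The partition makes distinct lists disjoint; the number of parts ensures that distinct vertices
    have distinct lists. *)
Lemma cover_list_uniq u v (x : H) : x \in L u -> x \in L v -> u = v.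
Proof.
have [/and3P[_ /trivIsetP triv _] cardL] := Defs.cover_partition HH.
have /imset_injP injL : #|[set L v | v : G]| == #|G| by rewrite cardL.
move=> xu xv; apply: injL => //; apply/eqP; apply: contraT => neq.
have := triv _ _ (imset_f L (erefl : u \in G)) (imset_f L (erefl : v \in G)) neq.
by move=> dis; have := disjointFr dis xu; rewrite xv.
Qed.

Lemma cover_list_mem (x : H) : exists v, x \in L v.
Proof.
have [/and3P[/eqP covL _ _] _] := Defs.cover_partition HH.
have : x \in finset.cover [set L v | v : G] by rewrite covL.
by case/bigcupP=> _ /imsetP[v _ ->]; exists v.
Qed.

Lemma cover_adj u v (x y : H) : x \in L u -> y \in L v -> adj x y -> adj u v.
Proof.
move=> xu yv xy.
have : [set x; y] \in edges H by apply/imset2P; exists x y; rewrite ?inE.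
rewrite cover_edges => /bigcupP[[p q] /= pq /imset2P[a b ap]].
rewrite inE => /andP[bq _] /eqP; rewrite eq_set2.
case/orP=> /andP[/eqP xE /eqP yE]; subst a b.
  by rewrite (cover_list_uniq xu ap) (cover_list_uniq yv bq).
by rewrite (cover_list_uniq xu bq) (cover_list_uniq yv ap) adj_sym.
Qed.

(** Once every list is labeled by [C] through [phi], transversals correspond to colorings via
    [f |-> T f]. *)
Lemma P_DPE (C : finType) (phi : G -> C -> H) :
  (forall v, injective (phi v)) -> (forall v, [set phi v c | c : C] = L v) ->
  P_DP HH = #|[set f : {ffun G -> C} |
    [forall u, forall v, ~~ adj (phi u (f u)) (phi v (f v))]]|.
Proof.
move=> phi_inj phi_im.
have phiL v c : phi v c \in L v by rewrite -phi_im imset_f.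
pose T (f : {ffun G -> C}) := [set phi v (f v) | v : G].
have memT f v c : (phi v c \in T f) = (c == f v).
  apply/imsetP/eqP => [[w _ E]|->]; last by exists v.
  have vw : v = w by apply: (@cover_list_uniq _ _ (phi v c)); rewrite // E.
  by move: E; rewrite -vw => /phi_inj.
rewrite /P_DP -[RHS](card_imset _ (f := T)); last first.
  move=> f g E; apply/ffunP => v; apply/eqP.
  by rewrite -memT -E memT.
apply: eq_card => A; rewrite inE; apply/andP/imsetP => [[/forallP tr ind]|].
  have /fin_all_exists[f fP] v : exists c, A :&: L v = [set phi v c].
    have /cards1P[x xE] := tr v.
    have /imsetP[c _ xc] : x \in [set phi v c | c : C].
      by rewrite phi_im; have := set11 x; rewrite -xE => /setIP[].
    by exists c; rewrite xE xc.
  have AE : A = T [ffun v => f v].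
    apply/setP => x; have [v xv] := cover_list_mem x.
    have /imsetP[c _ xE] : x \in [set phi v c | c : C] by rewrite phi_im.
    have /setP/(_ x) := fP v; rewrite !inE xv andbT => ->.
    by rewrite xE memT ffunE (inj_eq (@phi_inj v)).
  exists [ffun v => f v]; rewrite // inE; apply/forallP => u; apply/forallP => v.
  have inA w : phi w ([ffun v => f v] w) \in A by rewrite AE memT.
  by have /forall_inP/(_ _ (inA u))/forall_inP/(_ _ (inA v)) := ind.
case=> f; rewrite inE => /forallP fP ->; split.
  apply/forallP => v; apply/cards1P; exists (phi v (f v)); apply/setP => x.
  rewrite !inE; have [xv|xv] := boolP (x \in L v); last first.
    by rewrite andbF; apply/esym; apply: contraNF xv => /eqP->.
  have /imsetP[c _ ->] : x \in [set phi v c | c : C] by rewrite phi_im.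
  by rewrite memT andbT (inj_eq (@phi_inj v)).
apply/forall_inP => _ /imsetP[u _ ->]; apply/forall_inP => _ /imsetP[v _ ->].
by have /forallP := fP u.
Qed.

(** * Bijections read off a full cover *)

Section Full.
Variable m : nat.
Hypothesis full : full_m_fold HH m.

Definition cover_vertex v (i : 'I_m) : H :=
  enum_val (cast_ord (esym (full.1 v)) i).

Lemma cover_vertex_inj v : injective (cover_vertex v).
Proof. by move=> i j /enum_val_inj/cast_ord_inj. Qed.

Lemma cover_vertex_mem v i : cover_vertex v i \in L v.
Proof. exact: enum_valP. Qed.

Lemma cover_vertex_im v : [set cover_vertex v i | i : 'I_m] = L v.
Proof.
apply/eqP; rewrite eqEcard card_imset; last exact: cover_vertex_inj.
rewrite card_ord full.1 leqnn andbT; apply/fintype.subsetP => _ /imsetP[i _ ->].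
exact: cover_vertex_mem.
Qed.

Lemma matched_uniq u v (x y z : H) : adj u v ->
  x \in L u -> y \in L v -> z \in L v -> adj x y -> adj x z -> y = z.
Proof.
move=> uv xu yv zv xy xz; have /andP[_ /trivIsetP triv] := cover_matching HH uv.
have M w : w \in L v -> adj x w -> [set x; w] \in edges_between (L u) (L v).
  by move=> wv xw; apply/imset2P; exists x w; rewrite // inE wv.
have [|neq] := eqVneq [set x; y] [set x; z].
  move/eqP; rewrite eq_set2 eqxx /= => /orP[/eqP//|/andP[/eqP xz' /eqP yx]].
  by rewrite yx.
have := disjointFr (triv _ _ (M _ yv xy) (M _ zv xz) neq) (set21 x y).
by rewrite set21.
Qed.

(** There are [m] edges between the lists, and by [matched_uniq] distinct edges have distinct ends
    in [L u], so these ends exhaust [L u]. *)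
Lemma matched_ex u v (x : H) : adj u v -> x \in L u ->
  exists2 y, y \in L v & adj x y.
Proof.
move=> uv xu; pose D := [set p in setX (L u) (L v) | adj p.1 p.2].
have ED : edges_between (L u) (L v) = [set [set p.1; p.2] | p in D].
  apply/setP => e; apply/imset2P/imsetP => [[a b au]|[[a b]]].
    by rewrite inE => /andP[bv ab] ->; exists (a, b); rewrite ?inE ?au ?bv.
  by rewrite !inE => /andP[/andP[/= au bv] ab] ->; exists a b; rewrite ?inE ?bv.
have injD : {in D &, injective fst}.
  move=> [a b] [a' b'] /=; rewrite !inE => /andP[/andP[/= au bv] ab].
  move=> /andP[/andP[/= _ bv'] ab'] E; subst a'.
  by rewrite (matched_uniq uv au bv bv').
have : fst @: D == L u.
  rewrite eqEcard card_in_imset // full.1 -(full.2 _ _ uv) ED leq_imset_card.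
  by rewrite andbT; apply/fintype.subsetP => _ /imsetP[p + ->];
    rewrite !inE -andbA => /and3P[].
move/eqP/setP/(_ x); rewrite xu => /imsetP[[a y]].
by rewrite !inE => /andP[/andP[/= _ yv] ay] ->; exists y.
Qed.

(** The default [i] is never taken for adjacent [u] and [v], by [matched_ex]. *)
Definition cover_match u v (i : 'I_m) : 'I_m :=
  odflt i [pick j | adj (cover_vertex u i) (cover_vertex v j)].

Lemma cover_matchE u v i j : adj u v ->
  adj (cover_vertex u i) (cover_vertex v j) = (j == cover_match u v i).
Proof.
move=> uv; rewrite /cover_match; case: pickP => [k ik|no] /=.
  apply/idP/eqP => [ij|->//]; apply: (@cover_vertex_inj v).
  by apply: (matched_uniq uv _ _ _ ij ik); exact: cover_vertex_mem.
have [y yv iy] := matched_ex uv (cover_vertex_mem u i).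
have /imsetP[k _ yE] : y \in [set cover_vertex v i | i : 'I_m].
  by rewrite cover_vertex_im.
by move: (no k); rewrite -yE iy.
Qed.

Lemma cover_matchK u v :
  adj u v -> cancel (cover_match u v) (cover_match v u).
Proof.
move=> uv i; apply/eqP; rewrite eq_sym -cover_matchE; last by rewrite adj_sym.
by rewrite adj_sym cover_matchE.
Qed.

Lemma P_DP_match : P_DP HH = #|[set f : {ffun G -> 'I_m} |
  [forall u, forall v, adj u v ==> (f v != cover_match u v (f u))]]|.
Proof.
rewrite (P_DPE cover_vertex_inj cover_vertex_im); apply: eq_card => f.
rewrite !inE; apply: eq_forallb => u; apply: eq_forallb => v.
have [uv|uv] := boolP (adj u v); first by rewrite cover_matchE.
by apply: contra uv; apply: cover_adj; apply: cover_vertex_mem.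
Qed.

End Full.
End CoverFacts.

(** * Full covers built from a system of bijections *)

Section MatchingCover.
Variables (G : sgraph) (C : finType) (c0 : C) (s : G -> G -> C -> C).
Hypothesis sK : forall u v, adj u v -> cancel (s u v) (s v u).

Definition match_rel : rel (G * C)%type :=
  fun x y => adj x.1 y.1 && (y.2 == s x.1 y.1 x.2).

Lemma match_rel_sym : symmetric match_rel.
Proof.
move=> x y; rewrite /match_rel adj_sym; have [yx|//] := boolP (adj y.1 x.1).
by apply/eqP/eqP => ->; rewrite sK // adj_sym.
Qed.

Lemma match_rel_irr : irreflexive match_rel.
Proof. by move=> x; rewrite /match_rel adj_irr. Qed.

Definition match_graph : sgraph := SGraph match_rel_sym match_rel_irr.

Definition match_list (v : G) : {set match_graph} := [set x | x.1 == v].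

Lemma match_list_inj : injective match_list.
Proof.
by move=> u v /setP /(_ (u, c0)); rewrite !inE /= eqxx => /esym/eqP.
Qed.

Lemma match_partition :
  partition [set match_list v | v : G] [set: match_graph]
  /\ #|[set match_list v | v : G]| = #|G|.
Proof.
split; last by rewrite card_imset //; exact: match_list_inj.
apply/and3P; split.
- apply/eqP/setP => x; rewrite inE; apply/bigcupP.
  by exists (match_list x.1); [apply: imset_f | rewrite inE].
- apply/trivIsetP => _ _ /imsetP[u _ ->] /imsetP[v _ ->] neq.
  rewrite -setI_eq0; apply/eqP/setP => x; rewrite !inE.
  by apply/negP => /andP[/eqP xu /eqP xv]; rewrite -xu xv eqxx in neq.
- apply/imsetP => -[v _ /setP /(_ (v, c0))].
  by rewrite !inE /= eqxx.
Qed.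

Lemma match_edges_between (u v : G) : adj u v ->
  edges_between (match_list u) (match_list v) =
  [set [set ((u, i) : match_graph); (v, s u v i)] | i : C].
Proof.
move=> uv; apply/setP => e; apply/imset2P/imsetP.
- case=> -[a i] [b j]; rewrite !inE /= => /eqP->.
  by case/andP=> /eqP-> /andP[_ /= /eqP->] ->; exists i.
- case=> i _ ->; exists (u, i) (v, s u v i) => //; rewrite !inE ?eqxx //=.
  by rewrite /match_rel /= uv eqxx.
Qed.

(** Serves both for the matching condition and for counting the edges between two lists. *)
Lemma match_edge_inj (u v : G) i j x : adj u v ->
  x \in [set ((u, i) : match_graph); (v, s u v i)] ->
  x \in [set ((u, j) : match_graph); (v, s u v j)] -> i = j.
Proof.
move=> uv; have uv' : u != v by apply: contraTneq uv => ->; rewrite adj_irr.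
have vu' : v != u by rewrite eq_sym.
rewrite !inE => /orP[]/eqP-> /orP[]/eqP[] //.
- by move=> E; rewrite E eqxx in uv'.
- by move=> E; rewrite E eqxx in vu'.
- exact: (can_inj (sK uv)).
Qed.

Lemma match_matching (u v : G) : adj u v ->
  matching (edges_between (match_list u) (match_list v)).
Proof.
move=> uv; apply/andP; split.
  apply/fintype.subsetP => e /imset2P[x y xu]; rewrite inE => /andP[_ xy] ->.
  by apply/imset2P; exists x y; rewrite ?inE.
rewrite match_edges_between //.
apply/trivIsetP => _ _ /imsetP[i _ ->] /imsetP[j _ ->] neq.
rewrite -setI_eq0; apply/set0Pn => -[x /setIP[xi xj]].
by rewrite (match_edge_inj uv xi xj) eqxx in neq.
Qed.

Lemma match_edges :
  edges match_graph =
    \bigcup_(p : G * G | adj p.1 p.2)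
       edges_between (match_list p.1) (match_list p.2).
Proof.
apply/setP => e; apply/imset2P/bigcupP.
- case=> x y _; rewrite inE => /andP[_ xy] ->.
  case/andP: (xy) => xy1 _; exists (x.1, y.1) => //.
  by apply/imset2P; exists x y; rewrite ?inE ?eqxx.
- case=> p _ /imset2P[x y _]; rewrite inE => /andP[_ xy] ->.
  by exists x y; rewrite ?inE.
Qed.

Definition match_cover : dp_cover G :=
  DPCover match_partition match_matching match_edges.

Lemma match_list_im v : [set ((v, c) : match_graph) | c : C] = match_list v.
Proof.
apply/setP => -[w c]; rewrite inE /=.
by apply/imsetP/eqP => [[d _ [-> _]]|->] //; exists c.
Qed.

Lemma match_cover_full : full_m_fold match_cover #|C|.
Proof.
split=> [v|u v uv] /=; first by rewrite -match_list_im card_imset // => i j [].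
rewrite match_edges_between // card_imset // => i j E.
by apply: (match_edge_inj uv (set21 _ _)); rewrite -E set21.
Qed.

Lemma P_DP_match_cover : P_DP match_cover = #|[set f : {ffun G -> C} |
  [forall u, forall v, adj u v ==> (f v != s u v (f u))]]|.
Proof.
rewrite (P_DPE (HH := match_cover) (phi := fun v c => (v, c))); first last.
- exact: match_list_im.
- by move=> v i j [].
apply: eq_card => f; rewrite !inE.
by apply: eq_forallb => u; apply: eq_forallb => v;
  rewrite /= /match_rel negb_and -implybE.
Qed.

End MatchingCover.

Lemma proper_count_complete n (C : finType) (s : 'I_n -> 'I_n -> C -> C) :
  (forall u v, u != v -> cancel (s u v) (s v u)) ->
  proper_count s = #|[set f : {ffun complete_graph n -> C} |
  [forall u, forall v, adj u v ==> (f v != s u v (f u))]]|.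
Proof.
move=> sK; apply: eq_card => f; rewrite !inE; apply/eqP/forallP => [E u|H].
  apply/forallP => v; apply/implyP => uv; apply/negP => fE.
  by have := conflicts_set2 sK f uv; rewrite E inE fE.
apply/setP => e; rewrite [in RHS]inE; apply/negP => eC.
have := fintype.subsetP (conflicts_pairs s f) _ eC.
rewrite inE => /cards2P[u [v [uv eE]]]; move: eC; rewrite eE conflicts_set2 //.
by apply/negP; have /forallP/(_ v)/implyP := H u; apply.
Qed.

(** For [x] in [D], give one diagonal the color [x] and the other [r x]: all four edges are then
    conflicts, and the vertices off the cycle stay free. *)
Lemma four_cycle_lower (V C : finType) (s : V -> V -> C -> C)
    (D : {set C}) (r : C -> C) (S : {set {set V}}) :
  (forall u v, u != v -> cancel (s u v) (s v u)) ->
  (forall u v x, u != v -> x \in D -> s u v x = r x) ->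
  S \in four_cycles V -> #|D| * #|C| ^ (#|V| - 4) <= nconf s S.
Proof.
move=> sK sD /imsetP[[p q]]; rewrite !inE /= => /and3P[/eqP p2 /eqP q2 dis] ->.
(* The color at [a] keeps the families for different [x] apart. *)
have [a ap] : exists a, a \in p by apply/set0Pn; rewrite -cards_eq0 p2.
rewrite /nconf -[leqRHS]sum1_card.
rewrite [leqRHS](partition_big (fun f : {ffun V -> C} => f a) predT) //=.
rewrite -sum_nat_const [leqRHS](bigID (mem D)) /=.
apply: leq_trans (leq_addr _ _); apply: leq_sum => x xD.
have -> : 4 = #|p :|: q|.
  by rewrite cardsU (eqP (_ : p :&: q == set0)) ?setI_eq0 // cards0 p2 q2.
rewrite -(card_extensions _ (fun v => if v \in p then x else r x)) -sum1_card.
rewrite [leqRHS](bigID (fun f : {ffun V -> C} =>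
  [forall v in p :|: q, f v == if v \in p then x else r x])) /=.
apply: leq_trans (leq_addr _ _); rewrite leq_eqVlt; apply/orP; left; apply/eqP.
apply: eq_bigl => f; rewrite !inE; apply/idP/andP => [fE|[]//]; split=> //.
move/forall_inP: fE => fE.
have fp u : u \in p -> f u = x.
  by move=> up; rewrite (eqP (fE u _)) ?up // inE up.
have fq u : u \in q -> f u = r x.
  by move=> uq; rewrite (eqP (fE u _)) ?(disjointFl dis uq) // inE uq orbT.
rewrite (fp _ ap) eqxx andbT; apply/fintype.subsetP => _ /imset2P[u v up vq ->].
have uv : u != v by apply: contraTneq vq => <-; rewrite (disjointFr dis up).
by rewrite conflicts_set2 // (fp _ up) (fq _ vq) sD.
Qed.

Lemma derangement_almost_involutive m : 2 <= m ->
  exists r r' : 'I_m -> 'I_m, [/\ cancel r r', cancel r' r,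
    forall i, r i != i & m <= #|[set i | r (r i) == i]| + 3].
Proof.
case: m => // m m1.
(* Swap 2j and 2j+1, except that for an odd number of points the points 0, 1
   and the last one form a 3-cycle. *)
pose r0 i := if odd m.+1 && [|| i == 0, i == 1 | i == m]
  then (if i == 0 then 1 else if i == 1 then m else 0)
  else if odd i then i.-1 else i.+1.
have r0_lt i : i <= m -> r0 i < m.+1.
  by rewrite /r0 => im; repeat case: ifP => ?; lia.
pose r (i : 'I_m.+1) : 'I_m.+1 := inord (r0 i).
have rE i : r i = r0 i :> nat by rewrite inordK // r0_lt // -ltnS.
have r_inj : injective r.
  move=> [i im] [j jm] /(congr1 val); rewrite /= !rE /= => E; apply: val_inj => /=.
  by move: E im jm; rewrite /r0; repeat case: ifP => ?; lia.
exists r, (invF r_inj); split; [exact: invF_f | exact: f_invF | |].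
  by move=> i; apply/eqP => /(congr1 val);
    rewrite /= rE /r0; repeat case: ifP => ?; lia.
(* Outside these at most three points [r0] swaps neighbors, whatever the parity. *)
pose B := [set inord 0; inord 1; inord m : 'I_m.+1].
rewrite -[leqLHS]card_ord -[X in X <= _](cardsC [set i | r (r i) == i]) leq_add2l.
apply: (@leq_trans #|B|).
  apply/subset_leq_card/fintype.subsetP => i; rewrite !inE; apply: contraR.
  rewrite !negb_or -!val_eqE /= !rE !inordK // => /andP[/andP[i0 i1] im].
  have ilt := ltn_ord i; have -> : r0 i = if odd i then i.-1 else i.+1.
    by rewrite /r0; repeat case: ifP => ?; lia.
  by rewrite /r0; case oi: (odd i); repeat case: ifP => ?; lia.
by rewrite /B -setUA; do 2!rewrite cardsU1; rewrite cards1; lia.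
Qed.

(** * Binomial estimates for the error terms *)

Lemma bin_add_le t k : 'C(t, k) + 'C(t, k.+1) <= 2 ^ t.
Proof.
elim: t k => [|t IHt] [|k] //; rewrite ?bin0 !binS expnS.
  by have := IHt 0; rewrite !bin0; have := expn_gt0 2 t; lia.
by have := IHt k; have := IHt k.+1; lia.
Qed.

(** From [n] to [n.+1] the left side grows by the factor [(n + 1) / (n - 3)], at most 5, and the
    right side by [2 ^ n], at least 16. *)
Lemma bin4_le n : 4 <= n -> 9 * 'C(n, 4) <= 2 ^ ('C(n, 2) - 1).
Proof.
elim: n => // n IHn; rewrite leq_eqVlt => /orP[/eqP<- //|]; rewrite ltnS => n4.
have := IHn n4; have := mul_bin_down n.+1 4; rewrite /= subSS.
have tE : 'C(n.+1, 2) - 1 = 'C(n, 2) - 1 + n.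
  have : 1 <= 'C(n, 2) by rewrite bin_gt0; lia.
  by rewrite binS bin1; lia.
have : 2 ^ 4 <= 2 ^ n by rewrite leq_exp2l.
rewrite tE expnD; move: (2 ^ n) (2 ^ ('C(n, 2) - 1)) 'C(n, 4) 'C(n.+1, 4)
  => x y b b'.
move=> x16 E h.
have b5 : b' <= 5 * b by nia.
have xy : 16 * y <= y * x by rewrite [leqRHS]mulnC leq_mul2r x16 orbT.
lia.
Qed.

(** Each summand takes at most half of [2 ^ t]; for ['C(t, 5)] this is Pascal's rule and
    [bin_add_le] in row [t - 1]. *)
Lemma bin_error_le n (t := 'C(n, 2)) :
  4 <= n -> 9 * 'C(n, 4) + 'C(t, 5) <= 2 ^ t.
Proof.
move=> n4; have := bin4_le n4; rewrite -/t.
have : 0 < t by rewrite bin_gt0; lia.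
by case: t => // t _; rewrite subn1 /= binS expnS; have := bin_add_le t 4; lia.
Qed.

(** * The dual DP color function of complete graphs *)

Lemma dual_lower n m (t := 'C(n, 2)) : 4 <= n -> 2 <= m ->
  m ^ n + 'C(t, 2) * m ^ (n - 2) + 'C(n, 3) * m ^ (n - 3)
    + 3 * 'C(n, 4) * ((m - 3) * m ^ (n - 4))
  <= dual_P_DP (complete_graph n) m + t * m ^ (n - 1) + 'C(t, 3) * m ^ (n - 3)
     + 'C(t, 5) * m ^ (n - 4).
Proof.
move=> n4 m2; have m0 : 0 < m by exact: ltnW.
have [r [r' [rK r'K r_ne r_inv]]] := derangement_almost_involutive m2.
pose s (u v : 'I_n) := if u < v then r else r'.
have sK (u v : 'I_n) : u != v -> cancel (s u v) (s v u).
  by rewrite /s -val_eqE /=; case: ltngtP.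
have [_ dmax] := dual_P_DP_max (complete_graph n) m0.
have full := @match_cover_full (complete_graph n) 'I_m (Ordinal m0) s sK.
have := P_DP_match_cover (G := complete_graph n) (Ordinal m0) sK.
rewrite -(proper_count_complete sK) => PE.
rewrite card_ord in full; have := dmax _ full; rewrite PE.
suff : m ^ n + 'C(t, 2) * m ^ (n - 2) + 'C(n, 3) * m ^ (n - 3)
    + 3 * 'C(n, 4) * ((m - 3) * m ^ (n - 4))
  <= proper_count s + t * m ^ (n - 1) + 'C(t, 3) * m ^ (n - 3)
     + 'C(t, 5) * m ^ (n - 4) by lia.
have := @proper_count_lower 'I_n 'I_m s sK; rewrite !card_ord; apply=> //.
  move=> u v w x uv vw uw; rewrite /s.
  have {}uv : u != v :> nat := uv; have {}vw : v != w :> nat := vw.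
  have {}uw : u != w :> nat := uw; move: uv vw uw.
  have h1 := can_inj rK; have h2 := can_inj r'K.
  have r'_ne i : r' i != i.
    by apply: contra (r_ne i) => /eqP E; rewrite -{1}E r'K.
  (* In each order of [u], [v], [w], cancellation turns a triangle into a fixed point of [r] or
     [r']. *)
  case: (ltngtP u v) => // uv _; case: (ltngtP v w) => // vw _;
    case: (ltngtP u w) => // uw _; rewrite ?rK ?r'K ?(inj_eq h1) ?(inj_eq h2) //;
    rewrite ?r_ne ?r'_ne // 1?eq_sym ?r_ne ?r'_ne //; lia.
move=> S SC; have := four_cycle_lower (D := [set i | r (r i) == i]) (r := r) sK.
rewrite !card_ord => H; apply: leq_trans (H S _ SC); last first.
  (* Where [r (r x) = x], the maps [r] and [r'] agree, so the order of [u] and [v] does not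
     matter. *)
  move=> u v x uv; rewrite inE => /eqP E; rewrite /s; case: ifP => // _.
  by rewrite -{1}E rK.
by rewrite leq_mul2r; apply/orP; right; lia.
Qed.

(** [T] counts the triangles and [E] the triangles with one more edge; hiding them behind
    existentials leaves only arithmetic for the theorem. *)
Lemma P_DP_upper n m (t := 'C(n, 2)) (HH : dp_cover (complete_graph n)) :
  4 <= n -> 0 < m -> full_m_fold HH m ->
  exists T E, [/\
    P_DP HH + t * m ^ (n - 1) + 'C(t, 3) * m ^ (n - 3) + T
    <= m ^ n + 'C(t, 2) * m ^ (n - 2) + 'C(n, 3) * m ^ (n - 3)
       + 3 * 'C(n, 4) * m ^ (n - 3) + 'C(t, 4) * m ^ (n - 4) + E,
    E * m <= T * (t - 3) &
    triangle_free (cover_graph HH) \/ m ^ (n - 3) <= T].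
Proof.
move=> n4 m0 full; pose s := cover_match full.
have sK (u v : 'I_n) : u != v -> cancel (s u v) (s v u).
  exact: (@cover_matchK _ _ _ full).
exists (triangle_count (V := 'I_n) s), (triangle_edge_count (V := 'I_n) s); split.
- have := @proper_count_upper 'I_n 'I_m s sK; rewrite !card_ord.
  by rewrite (proper_count_complete sK) (P_DP_match full); apply.
- have := @triangle_edge_bound 'I_n 'I_m s sK; rewrite !card_ord; exact.
have [tf|ntf] := boolp.pselect (triangle_free (cover_graph HH)); [by left|right].
have [x [y [z [xy yz xz]]]] : exists x y z : cover_graph HH,
    [/\ adj x y, adj y z & adj x z].
  by apply: boolp.contrapT => no; apply: ntf => x y z h; apply: no; exists x, y, z.
have [u xu] := cover_list_mem x; have [v yv] := cover_list_mem y.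
have [w zw] := cover_list_mem z.
have uv := cover_adj xu yv xy; have vw := cover_adj yv zw yz.
have uw := cover_adj xu zw xz.
move: xu yv zw; rewrite -!(cover_vertex_im full).
move=> /imsetP[i _ xE] /imsetP[j _ yE] /imsetP[k _ zE]; subst x y z.
move: xy yz xz; rewrite !cover_matchE // => /eqP jE /eqP kE /eqP kE'.
have := @triangle_count_lower 'I_n 'I_m s sK u v w i uv vw uw.
by rewrite !card_ord; apply; rewrite /s -jE -kE -kE'.
Qed.

Local Open Scope ring_scope.

Theorem theorem6 (n m : nat) (hn : (4 <= n)%N) (hm : (1 <= m)%N) :
  let G := complete_graph n in
  let t := 'C(n, 2) in
  let f : int :=
    m%:Z ^+ n - t%:Z * m%:Z ^+ (n - 1) + 'C(t, 2)%:Z * m%:Z ^+ (n - 2)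
    - ('C(t, 3)%:Z - 'C(n, 3)%:Z - 3 * 'C(n, 4)%:Z) * m%:Z ^+ (n - 3) in
  2 ^+ (t + 1) + t%:Z + n%:Z - 6 < m%:Z ->
  (forall HH : dp_cover G,
     full_m_fold HH m -> P_DP HH = dual_P_DP G m ->
     triangle_free (cover_graph HH)) /\
  f - 2 ^+ t * m%:Z ^+ (n - 4) <= (dual_P_DP G m)%:Z
    <= f + 2 ^+ t * m%:Z ^+ (n - 4).
Proof.
move=> G t f; have natE (a k : nat) : a%:Z ^+ k = (a ^ k)%N%:Z.
  by rewrite -!natz -natrX.
rewrite /f -[2]/(2%:Z) !natE addn1 expnS => mt.
have t6 : (6 <= t)%N.
  by apply: (@leq_trans 'C(4, 2)) => //; apply: leq_bin2l.
have m4 : (t + n + 2 * 2 ^ t < m + 6)%N by lia.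
have bin4 : ('C(t, 4) <= 2 ^ t)%N.
  by apply: leq_trans (bin_add_le t 4); apply: leq_addr.
have err := bin_error_le hn; rewrite -/t in err.
(* Puts the cubic-order terms and the error terms over the common power [m ^ (n - 4)]. *)
have m3E : (m ^ (n - 3) = m * m ^ (n - 4))%N.
  by rewrite -expnS; congr (_ ^ _)%N; lia.
have m2 : (2 <= m)%N by lia.
have := dual_lower hn m2; rewrite -/G -/t m3E => low.
have bounds := @P_DP_upper n m; rewrite -/G -/t m3E in bounds.
clear f; clearbody t G.
have [[HH0 full0 P0] _] := dual_P_DP_max G hm.
have upper (HH : dp_cover G) : full_m_fold HH m ->
    (P_DP HH + t * m ^ (n - 1) + 'C(t, 3) * (m * m ^ (n - 4))
     <= m ^ n + 'C(t, 2) * m ^ (n - 2) + 'C(n, 3) * (m * m ^ (n - 4))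
        + 3 * 'C(n, 4) * (m * m ^ (n - 4)) + 2 ^ t * m ^ (n - 4))%N /\
    (triangle_free (cover_graph HH) \/
     P_DP HH + t * m ^ (n - 1) + 'C(t, 3) * (m * m ^ (n - 4))
       + (m + 3 - t) * m ^ (n - 4)
     <= m ^ n + 'C(t, 2) * m ^ (n - 2) + 'C(n, 3) * (m * m ^ (n - 4))
        + 3 * 'C(n, 4) * (m * m ^ (n - 4)) + 2 ^ t * m ^ (n - 4))%N.
  move=> full; have [T [E [up ET dich]]] := bounds HH hn hm full.
  have b4 : ('C(t, 4) * m ^ (n - 4) <= 2 ^ t * m ^ (n - 4))%N.
    by rewrite leq_mul2r bin4 orbT.
  (* Since [t - 3 <= m], the returned amount [E] never exceeds the cost [T]. *)
  have le : (E <= T)%N by rewrite -(leq_pmul2r hm); nia.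
  split; first by lia.
  case: dich => [tf|mT]; [by left|right].
  (* Multiplied by [m], the difference of [T] and [E] is at least [T * (m - (t - 3))], and [T] is at
     least [m * m ^ (n - 4)]. *)
  have : ((m + 3 - t) * m ^ (n - 4) + E <= T)%N; last by lia.
  rewrite -(leq_pmul2r hm) mulnDl.
  have h : ((m + 3 - t) * (m * m ^ (n - 4)) <= (m + 3 - t) * T)%N.
    by rewrite leq_mul2l mT orbT.
  have : ((m + 3 - t) * T + T * (t - 3) = T * m)%N.
    by rewrite [in LHS]mulnC -mulnDr; congr (_ * _)%N; lia.
  by lia.
have M0 : (0 < m ^ (n - 4))%N by rewrite expn_gt0 hm.
have err' : (9 * 'C(n, 4) * m ^ (n - 4) + 'C(t, 5) * m ^ (n - 4)
             <= 2 ^ t * m ^ (n - 4))%N by rewrite -mulnDl leq_mul2r err orbT.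
have {}low : (m ^ n + 'C(t, 2) * m ^ (n - 2) + 'C(n, 3) * (m * m ^ (n - 4))
    + 3 * 'C(n, 4) * (m * m ^ (n - 4))
  <= dual_P_DP G m + t * m ^ (n - 1) + 'C(t, 3) * (m * m ^ (n - 4))
     + 2 ^ t * m ^ (n - 4))%N.
  (* Three colors may fail to close up along each of the [3 * 'C(n, 4)] 4-cycles, whence the 9. *)
  have : (3 * 'C(n, 4) * (m * m ^ (n - 4))
    = 3 * 'C(n, 4) * ((m - 3) * m ^ (n - 4)) + 9 * 'C(n, 4) * m ^ (n - 4))%N.
    have -> : (m * m ^ (n - 4) = (m - 3) * m ^ (n - 4) + 3 * m ^ (n - 4))%N.
      by rewrite -mulnDl; congr (_ * _)%N; lia.
    by lia.
  by lia.
split=> [HH full PE|]; last first.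
  by have [up _] := upper _ full0; rewrite P0 in up; lia.
have [_ [//|]] := upper _ full; rewrite PE => up.
(* The threshold on [m] and [4 <= n] make the net loss from a triangle exceed the gap between the
   two bounds, so a cover with a triangle cannot be optimal. *)
have : (2 * 2 ^ t * m ^ (n - 4) < (m + 3 - t) * m ^ (n - 4))%N.
  by rewrite ltn_pmul2r //; lia.
by lia.
Qed.
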